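(* Conditional bisimilarity and representative conditional bisimilarity coincide: ${\simeq_C}={\simeq_R}$.
   Context: Composition of $f\colon A\to B$, $g\colon B\to C$ is written $f;g$. Fix a category $\mathbf C$ with distinguished object $0$ and a representative class $\kappa$ of commuting squares: for every commuting square $\alpha_1;\delta_1=\alpha_2;\delta_2$ there are $(\alpha_1,\alpha_2,\beta_1,\beta_2)\in\kappa$ (a commuting square) and $\gamma$ with $\delta_1=\beta_1;\gamma$, $\delta_2=\beta_2;\gamma$; $\kappa(\alpha_1,\alpha_2)$ is the set of $(\beta_1,\beta_2)$ with $(\alpha_1,\alpha_2,\beta_1,\beta_2)\in\kappa$. Conditions over $A$ are defined inductively as $(A,\mathcal Q,S)$, $\mathcal Q\in\{\forall,\exists\}$, $S$ a finite set of pairs $(h,\mathcal A')$ with $h\colon A\to A'$, $\mathcal A'$ a condition over $A'$. For $a\colon A\to B$: $a\models(A,\forall,S)$ iff for all $(h,\mathcal A')\in S$ and all $g$ with $a=h;g$, $g\models\mathcal A'$; $a\models(A,\exists,S)$ iff some $(h,\mathcal A')\in S$ and $g$ satisfy $a=h;g$, $g\models\mathcal A'$. $\mathcal A\models\mathcal B$: every arrow satisfying $\mathcal A$ satisfies $\mathcal B$. Boolean connectives have the standard semantics. Shift along $c\colon A\to B$: $(A,\mathcal Q,S)_{\downarrow c}=(B,\mathcal Q,\{(\beta,\mathcal A'_{\downarrow\alpha})\mid(h,\mathcal A')\in S,(\alpha,\beta)\in\kappa(h,c)\})$; it satisfies $c;d\models\mathcal A\iff d\models\mathcal A_{\downarrow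 c}$. A conditional reactive system is a set $\mathcal S$ of rules $(\ell,r,\mathcal R)$, $\ell,r\colon0\to I$, $\mathcal R$ a condition over $I$. Context step $a\xrightarrow[C]{f,\ \mathcal A}a'$ ($a\colon0\to J$, $f\colon J\to K$, $a'\colon0\to K$, $\mathcal A$ over $K$): there are a rule $(\ell,r,\mathcal R)\in\mathcal S$ and $c\colon I\to K$ with $a;f=\ell;c$, $a'=r;c$, $\mathcal A\models\mathcal R_{\downarrow c}$. Representative step $a\xrightarrow[R]{f,\ \mathcal A}a'$: a context step with additionally $(f,c)\in\kappa(a,\ell)$ and $\mathcal A=\mathcal R_{\downarrow c}$. A conditional relation is a set of triples $(a,b,\mathcal C)$, $a,b\colon0\to J$, $\mathcal C$ a condition over $J$. $\mathcal D\models\bigvee_{i\in I}\mathcal E_i$ (possibly infinite $I$): every arrow satisfying $\mathcal D$ satisfies some $\mathcal E_i$. A conditional bisimulation is a conditional relation $R$ such that for each $(a,b,\mathcal C)\in R$ and each context step $a\xrightarrow[C]{f,\ \mathcal A}a'$ there are an index set $I$, context steps $b\xrightarrow[C]{f,\ \mathcal B_i}b'_i$ and conditions $\mathcal C'_i$ with $(a',b'_i,\mathcal C'_i)\in R$ and $\mathcal A\land\mathcal C_{\downarrow f}\models\bigvee_{i\in I}(\mathcal C'_i\land\mathcal B_i)$, and symmetrically for context steps of $b$. A representative conditional bisimulation is defined identically except that only representative steps $a\xrightarrow[R]{f,\ \mathcal A}a'$ (resp. of $b$) need to be answered (still by context steps). $\simeq_C$ (resp. $\simeq_R$) is the set of triples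 contained in some conditional bisimulation (resp. representative conditional bisimulation). *)

(* Defs.v *)
From Stdlib Require Import List.

Set Implicit Arguments.
Unset Strict Implicit.
Unset Printing Implicit Defensive.

(* Composition is in diagrammatic order. *)
Record category := Category {
  ob :> Type;
  hom : ob -> ob -> Type;
  idm : forall A, hom A A;
  comp : forall A B C, hom A B -> hom B C -> hom A C;
  comp_idl : forall A B (f : hom A B), comp (idm A) f = f;
  comp_idr : forall A B (f : hom A B), comp f (idm B) = f;
  comp_assoc : forall A B C D (f : hom A B) (g : hom B C) (h : hom C D),
    comp f (comp g h) = comp (comp f g) h
}.

Arguments hom {c} A B.
Arguments idm {c} A.
Arguments comp {c A B C} f g.

Notation "f ;; g" := (comp f g) (at level 40, left associativity).

Record cospan (C : category) (B1 B2 : C) := Cospan {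
  apex : C;
  leg1 : hom B1 apex;
  leg2 : hom B2 apex
}.

(* [kappa a1 a2 b1 b2] means that (a1, a2, b1, b2) belongs to the class.
   Conditions have finitely many branches, so the shift operation only makes
   sense when every set kappa(a1, a2) is finite: [kappa_enum a1 a2] lists it. *)
Record representative_class (C : category) := RepresentativeClass {
  kappa : forall A B1 B2 D : C,
    hom A B1 -> hom A B2 -> hom B1 D -> hom B2 D -> Prop;
  kappa_commutes : forall (A B1 B2 D : C) (a1 : hom A B1) (a2 : hom A B2)
    (b1 : hom B1 D) (b2 : hom B2 D),
    kappa a1 a2 b1 b2 -> a1 ;; b1 = a2 ;; b2;
  kappa_represents : forall (A B1 B2 E : C) (a1 : hom A B1) (a2 : hom A B2)
    (d1 : hom B1 E) (d2 : hom B2 E),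
    a1 ;; d1 = a2 ;; d2 ->
    exists (D : C) (b1 : hom B1 D) (b2 : hom B2 D) (g : hom D E),
      kappa a1 a2 b1 b2 /\ d1 = b1 ;; g /\ d2 = b2 ;; g;
  kappa_enum : forall A B1 B2 : C,
    hom A B1 -> hom A B2 -> list (cospan B1 B2);
  kappa_enumP : forall (A B1 B2 D : C) (a1 : hom A B1) (a2 : hom A B2)
    (b1 : hom B1 D) (b2 : hom B2 D),
    kappa a1 a2 b1 b2 <-> In (Cospan b1 b2) (kappa_enum a1 a2)
}.

Inductive quantifier := QForall | QExists.

(* The finite set of branches is represented by a list; order and
   multiplicity of branches are irrelevant for satisfaction. *)
Inductive cond (C : category) (A : C) : Type :=
| Cond : quantifier -> list (branch A) -> cond A
with branch (C : category) (A : C) : Type :=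
| Branch : forall A' : C, hom A A' -> cond A' -> branch A.

Fixpoint sat (C : category) (A : C) (cA : cond A) (B : C) (a : hom A B)
    {struct cA} : Prop :=
  match cA with
  | Cond QForall brs =>
      fold_right and True
        (map (fun br => match br with
                        | Branch h cA' => forall g, a = h ;; g -> sat cA' g
                        end) brs)
  | Cond QExists brs =>
      fold_right or False
        (map (fun br => match br with
                        | Branch h cA' => exists g, a = h ;; g /\ sat cA' g
                        end) brs)
  end.

Lemma sat_forallP (C : category) (A B : C) (brs : list (branch A))
    (a : hom A B) :
  sat (Cond QForall brs) a <->
  (forall (A' : C) (h : hom A A') (cA' : cond A'), In (Branch h cA') brs ->
   forall g : hom A' B, a = h ;; g -> sat cA' g).
Proof.
split; simpl; induction brs as [|br brs IH]; simpl.
- easy.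
- intros [H1 H2] A' h cA' [->|Hin]; [exact H1|exact (IH H2 _ _ _ Hin)].
- easy.
- intros H; split.
  + destruct br as [A' h cA']; exact (H _ _ _ (or_introl eq_refl)).
  + apply IH; intros A' h cA' Hin; exact (H _ _ _ (or_intror Hin)).
Qed.

Lemma sat_existsP (C : category) (A B : C) (brs : list (branch A))
    (a : hom A B) :
  sat (Cond QExists brs) a <->
  (exists (A' : C) (h : hom A A') (cA' : cond A'), In (Branch h cA') brs /\
   exists g : hom A' B, a = h ;; g /\ sat cA' g).
Proof.
split; simpl; induction brs as [|br brs IH]; simpl.
- easy.
- intros [H|H].
  + destruct br as [A' h cA']; exists A', h, cA'.
    split; [left; reflexivity|exact H].
  + destruct (IH H) as (A' & h & cA' & Hin & Hg).
    exists A', h, cA'; split; [right; exact Hin|exact Hg].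
- intros (A' & h & cA' & [] & _).
- intros (A' & h & cA' & [->|Hin] & Hg).
  + left; exact Hg.
  + right; apply IH; exists A', h, cA'; split; assumption.
Qed.

Fixpoint shift (C : category) (kap : representative_class C) (A : C)
    (cA : cond A) (B : C) (c : hom A B) {struct cA} : cond B :=
  match cA with
  | Cond q brs =>
      Cond q (flat_map (fun br =>
        match br with
        | Branch h cA' =>
            map (fun s => Branch (leg2 s) (shift kap cA' (leg1 s)))
                (kappa_enum kap h c)
        end) brs)
  end.

(* Properties of arrows out of [A], in which Boolean combinations of
   conditions are interpreted. *)
Definition property (C : category) (A : C) := forall B : C, hom A B -> Prop.

Definition sem (C : category) (A : C) (cA : cond A) : property A :=
  fun B a => sat cA a.

Definition conj_prop (C : category) (A : C) (P Q : property A) : property A :=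
  fun B a => P B a /\ Q B a.

Definition disj_prop (C : category) (A : C) (I : Type) (P : I -> property A) :
    property A :=
  fun B a => exists i, P i B a.

Definition entails (C : category) (A : C) (P Q : property A) : Prop :=
  forall (B : C) (a : hom A B), P B a -> Q B a.

(* The set of rules (l, r, R), with l, r : O -> I and R a condition over I. *)
Definition reactive_system (C : category) (O : C) :=
  forall I : C, hom O I -> hom O I -> cond I -> Prop.

Definition step_relation (C : category) (O : C) :=
  forall J K : C, hom O J -> hom J K -> cond K -> hom O K -> Prop.

Definition context_step_via (C : category) (O : C)
    (kap : representative_class C) (Sys : reactive_system O) (J K : C)
    (a : hom O J) (f : hom J K) (cA : cond K) (a' : hom O K)
    (I : C) (l r : hom O I) (R : cond I) (c : hom I K) : Prop :=
  Sys I l r R /\ a ;; f = l ;; c /\ a' = r ;; c /\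
  entails (sem cA) (sem (shift kap R c)).

Definition context_step (C : category) (O : C) (kap : representative_class C)
    (Sys : reactive_system O) : step_relation O :=
  fun J K a f cA a' =>
    exists (I : C) (l r : hom O I) (R : cond I) (c : hom I K),
      context_step_via kap Sys a f cA a' l r R c.

Definition representative_step (C : category) (O : C)
    (kap : representative_class C) (Sys : reactive_system O) :
    step_relation O :=
  fun J K a f cA a' =>
    exists (I : C) (l r : hom O I) (R : cond I) (c : hom I K),
      context_step_via kap Sys a f cA a' l r R c /\
      kappa kap a l f c /\ cA = shift kap R c.

Definition conditional_relation (C : category) (O : C) :=
  forall J : C, hom O J -> hom O J -> cond J -> Prop.

Definition converse (C : category) (O : C) (R : conditional_relation O) :
    conditional_relation O :=
  fun J a b cC => R J b a cC.

(* Each [step] of the first component is answered by context steps of the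
   second one. *)
Definition simulates (C : category) (O : C) (kap : representative_class C)
    (Sys : reactive_system O) (step : step_relation O)
    (R : conditional_relation O) : Prop :=
  forall (J : C) (a b : hom O J) (cC : cond J), R J a b cC ->
  forall (K : C) (f : hom J K) (cA : cond K) (a' : hom O K),
    step J K a f cA a' ->
    exists (I : Type) (b' : I -> hom O K) (cB cC' : I -> cond K),
      (forall i, context_step kap Sys b f (cB i) (b' i)) /\
      (forall i, R K a' (b' i) (cC' i)) /\
      entails (conj_prop (sem cA) (sem (shift kap cC f)))
        (disj_prop (fun i => conj_prop (sem (cC' i)) (sem (cB i)))).

Definition conditional_bisimulation (C : category) (O : C)
    (kap : representative_class C) (Sys : reactive_system O)
    (R : conditional_relation O) : Prop :=
  simulates kap Sys (context_step kap Sys) R /\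
  simulates kap Sys (context_step kap Sys) (converse R).

Definition representative_conditional_bisimulation (C : category) (O : C)
    (kap : representative_class C) (Sys : reactive_system O)
    (R : conditional_relation O) : Prop :=
  simulates kap Sys (representative_step kap Sys) R /\
  simulates kap Sys (representative_step kap Sys) (converse R).

Definition conditional_bisimilarity (C : category) (O : C)
    (kap : representative_class C) (Sys : reactive_system O) :
    conditional_relation O :=
  fun J a b cC => exists R : conditional_relation O,
    conditional_bisimulation kap Sys R /\ R J a b cC.

Definition representative_conditional_bisimilarity (C : category) (O : C)
    (kap : representative_class C) (Sys : reactive_system O) :
    conditional_relation O :=
  fun J a b cC => exists R : conditional_relation O,
    representative_conditional_bisimulation kap Sys R /\ R J a b cC.

(* Main.v *)
From Stdlib Require Import List.
Require Import Defs.

Set Implicit Arguments.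
Unset Strict Implicit.
Unset Printing Implicit Defensive.

(** Every context step of [a ;; d] factors through a representative step of
    [a], so the closure of a representative conditional bisimulation under
    composition with a context [d], with conditions shifted along [d], is a
    conditional bisimulation: the answers to the representative step, extended
    by the remaining context, answer the given step. *)

(** Subconditions sit inside a list of branches, so the recursion passes through the list: the inner
    induction on [brs] hands the condition of each member to the outer fixpoint. *)
Lemma cond_branch_ind (C : category) (P : forall A : C, cond A -> Prop) :
  (forall (A : C) q (brs : list (branch A)),
     (forall (A' : C) (h : hom A A') (cA' : cond A'),
        In (Branch h cA') brs -> P A' cA') ->
     P A (Cond q brs)) ->
  forall (A : C) (cA : cond A), P A cA.
Proof.
intros HP; fix IH 2; intros A [q brs]; apply HP.
induction brs as [|[A0 h0 c0] brs IHbrs]; intros A' h cA'; simpl.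
- intros [].
- intros [E|Hin]; [|exact (IHbrs _ _ _ Hin)].
  (* The equation is inverted without axiom K by projecting the branch to a
     proposition. *)
  exact (match E in _ = br return
           match br with Branch _ c => P _ c end
         with eq_refl => IH A0 c0 end).
Qed.

(** The last conjunct stays an equation between whole branches, since splitting it would compare
    arrows whose targets are only propositionally equal. *)
Lemma in_shift (C : category) (kap : representative_class C) (A B : C)
    (brs : list (branch A)) (c : hom A B) (D : C) (beta : hom B D)
    (cD : cond D) :
  In (Branch beta cD)
     (flat_map (fun br => match br with
        | Branch h cA' => map (fun s => Branch (leg2 s) (shift kap cA' (leg1 s)))
                              (kappa_enum kap h c)
        end) brs) <->
  exists (A' : C) (h : hom A A') (cA' : cond A') (s : cospan A' B),
    In (Branch h cA') brs /\ In s (kappa_enum kap h c) /\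
    Branch (leg2 s) (shift kap cA' (leg1 s)) = Branch beta cD.
Proof.
rewrite in_flat_map; split.
- intros ([A' h cA'] & Hin & Hs); apply in_map_iff in Hs.
  destruct Hs as (s & E & Hs); exists A', h, cA', s; auto.
- intros (A' & h & cA' & s & Hin & Hs & E).
  exists (Branch h cA'); split; [exact Hin|].
  apply in_map_iff; exists s; auto.
Qed.

Lemma kappa_enum_commutes (C : category) (kap : representative_class C)
    (A B1 B2 : C) (a1 : hom A B1) (a2 : hom A B2) (s : cospan B1 B2) :
  In s (kappa_enum kap a1 a2) -> a1 ;; leg1 s = a2 ;; leg2 s.
Proof.
destruct s as [D b1 b2]; intros Hs; apply (kappa_commutes (r := kap)).
now apply kappa_enumP.
Qed.

Lemma kappa_enum_represents (C : category) (kap : representative_class C)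
    (A B1 B2 E : C) (a1 : hom A B1) (a2 : hom A B2)
    (d1 : hom B1 E) (d2 : hom B2 E) :
  a1 ;; d1 = a2 ;; d2 ->
  exists (s : cospan B1 B2) (g : hom (apex s) E),
    In s (kappa_enum kap a1 a2) /\ d1 = leg1 s ;; g /\ d2 = leg2 s ;; g.
Proof.
intros H; destruct (kappa_represents kap H) as (D & b1 & b2 & g & Hk & E1 & E2).
exists (Cospan b1 b2), g; split; [now apply kappa_enumP|auto].
Qed.

(** A factorisation [c ;; d = h ;; g] is a commuting square, so it factors through some [s] in
    [kappa_enum kap h c], which makes [d] factor through [leg2 s]. Conversely, a factorisation of
    [d] through [leg2 s] pastes with the square [s] to one of [c ;; d] through [h]. *)
Lemma sat_shift (C : category) (kap : representative_class C) (A : C)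
    (cA : cond A) :
  forall (B D : C) (c : hom A B) (d : hom B D),
    sat (shift kap cA c) d <-> sat cA (c ;; d).
Proof.
revert A cA.
apply (cond_branch_ind (P := fun A cA => forall (B D : C) (c : hom A B)
  (d : hom B D), sat (shift kap cA c) d <-> sat cA (c ;; d))).
intros A q brs IH; cbn beta in IH.
intros B D c d.
destruct q; cbn [shift].
- rewrite !sat_forallP; split.
  + intros H A' h cA' Hin g Hg.
    destruct (kappa_enum_represents kap (eq_sym Hg)) as (s & g' & Hs & Eg & Ed).
    rewrite Eg; apply (IH _ _ _ Hin).
    apply (H _ (leg2 s) (shift kap cA' (leg1 s))); [|exact Ed].
    apply in_shift; exists A', h, cA', s; auto.
  + intros H D' beta cD Hin; apply in_shift in Hin.
    destruct Hin as (A' & h & cA' & s & Hin & Hs & E).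
    (* Transport along [E] replaces [beta] and [cD] by the components of the shifted branch. *)
    refine (match E in _ = br return
              match br with Branch beta cD =>
                forall g, d = beta ;; g -> sat cD g end
            with eq_refl => _ end).
    intros g Hg; apply (IH _ _ _ Hin), (H _ _ _ Hin).
    now rewrite Hg, !comp_assoc, (kappa_enum_commutes Hs).
- rewrite !sat_existsP; split.
  + intros (D' & beta & cD & Hin & Hg); apply in_shift in Hin.
    destruct Hin as (A' & h & cA' & s & Hin & Hs & E).
    assert (Hg' : exists g, d = leg2 s ;; g /\ sat (shift kap cA' (leg1 s)) g).
    { exact (match eq_sym E in _ = br return
               match br with Branch beta cD =>
                 exists g, d = beta ;; g /\ sat cD g end
             with eq_refl => Hg end). }
    destruct Hg' as (g & Eg & Hsat).
    exists A', h, cA'; split; [exact Hin|].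
    exists (leg1 s ;; g); split; [|now apply (IH _ _ _ Hin)].
    now rewrite Eg, !comp_assoc, (kappa_enum_commutes Hs).
  + intros (A' & h & cA' & Hin & g & Hg & Hsat).
    destruct (kappa_enum_represents kap (eq_sym Hg)) as (s & g' & Hs & Eg & Ed).
    exists _, (leg2 s), (shift kap cA' (leg1 s)); split.
    * apply in_shift; exists A', h, cA', s; auto.
    * exists g'; split; [exact Ed|apply (IH _ _ _ Hin)]; now rewrite <- Eg.
Qed.

Lemma representative_step_context (C : category) (O : C)
    (kap : representative_class C) (Sys : reactive_system O) (J K : C)
    (a : hom O J) (f : hom J K) (cA : cond K) (a' : hom O K) :
  representative_step kap Sys a f cA a' -> context_step kap Sys a f cA a'.
Proof.
intros (I & l & r & R & c & H & _); exists I, l, r, R, c; exact H.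
Qed.

(** The square [a ;; f = l ;; c] factors through a square [(f0, c0)] of the class with mediating
    arrow [g]. As [c = c0 ;; g], shifting [R] along [c] or along [c0] and then [g] gives conditions
    that are equivalent, though perhaps not equal. *)
Lemma context_step_factor (C : category) (O : C)
    (kap : representative_class C) (Sys : reactive_system O) (J K : C)
    (a : hom O J) (f : hom J K) (cA : cond K) (a' : hom O K) :
  context_step kap Sys a f cA a' ->
  exists (K0 : C) (f0 : hom J K0) (cA0 : cond K0) (a0' : hom O K0)
    (g : hom K0 K),
    representative_step kap Sys a f0 cA0 a0' /\
    f = f0 ;; g /\ a' = a0' ;; g /\ entails (sem cA) (sem (shift kap cA0 g)).
Proof.
intros (I & l & r & R & c & Hrule & Haf & Ha' & HA).
destruct (kappa_represents kap Haf) as (K0 & f0 & c0 & g & Hk & Ef & Ec).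
exists K0, f0, (shift kap R c0), (r ;; c0), g; repeat split.
- exists I, l, r, R, c0; repeat split; auto.
  + exact (kappa_commutes Hk).
  + intros E h Hh; exact Hh.
- exact Ef.
- now rewrite Ha', Ec, comp_assoc.
- intros E h Hh; specialize (HA E h Hh); unfold sem in *.
  rewrite sat_shift in HA |- *.
  now rewrite sat_shift, comp_assoc, <- Ec.
Qed.

(** The same rule applies, with reactive context [c ;; g] instead of [c]. *)
Lemma context_step_extend (C : category) (O : C)
    (kap : representative_class C) (Sys : reactive_system O) (J K L : C)
    (a : hom O J) (f : hom J K) (cA : cond K) (a' : hom O K) (g : hom K L) :
  context_step kap Sys a f cA a' ->
  context_step kap Sys a (f ;; g) (shift kap cA g) (a' ;; g).
Proof.
intros (I & l & r & R & c & Hrule & Haf & Ha' & HA).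
exists I, l, r, R, (c ;; g); repeat split.
- exact Hrule.
- now rewrite !comp_assoc, Haf.
- now rewrite Ha', comp_assoc.
- intros E h Hh; unfold entails, sem in *; rewrite sat_shift in Hh.
  apply HA in Hh; rewrite sat_shift in Hh |- *.
  now rewrite <- comp_assoc.
Qed.

(** A context step depends on its source and its label only through their composite. *)
Lemma context_step_comp (C : category) (O : C)
    (kap : representative_class C) (Sys : reactive_system O) (J K L : C)
    (a : hom O J) (d : hom J K) (f : hom K L) (cA : cond L) (a' : hom O L) :
  context_step kap Sys (a ;; d) f cA a' <->
  context_step kap Sys a (d ;; f) cA a'.
Proof.
unfold context_step, context_step_via; now rewrite <- comp_assoc.
Qed.

(** Entailment replaces equality with the shifted condition because a shift along an identity
    preserves a condition only up to equivalence; with it, the closure contains [R]. *)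
Definition context_closure (C : category) (O : C)
    (kap : representative_class C) (R : conditional_relation O) :
    conditional_relation O :=
  fun J a b cC => exists (J0 : C) (a0 b0 : hom O J0) (cC0 : cond J0)
    (d : hom J0 J),
    R J0 a0 b0 cC0 /\ a = a0 ;; d /\ b = b0 ;; d /\
    entails (sem cC) (sem (shift kap cC0 d)).

Lemma context_closure_incl (C : category) (O : C)
    (kap : representative_class C) (R : conditional_relation O) (J : C)
    (a b : hom O J) (cC : cond J) :
  R J a b cC -> context_closure kap R a b cC.
Proof.
intros HR; exists J, a, b, cC, (idm J); rewrite !comp_idr.
repeat split; [exact HR|]; intros E h Hh.
unfold sem; now rewrite sat_shift, comp_idl.
Qed.

Lemma context_closure_converse (C : category) (O : C)
    (kap : representative_class C) (R : conditional_relation O) (J : C)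
    (a b : hom O J) (cC : cond J) :
  context_closure kap (converse R) a b cC <->
  converse (context_closure kap R) a b cC.
Proof.
split; intros (J0 & a0 & b0 & cC0 & d & HR & Ea & Eb & HC);
  exists J0, b0, a0, cC0, d; auto.
Qed.

(** Closure and converse commute only pointwise, so simulation has to be transported along an
    equivalence of relations. *)
Lemma simulates_ext (C : category) (O : C) (kap : representative_class C)
    (Sys : reactive_system O) (step : step_relation O)
    (R R' : conditional_relation O) :
  (forall J (a b : hom O J) cC, R J a b cC <-> R' J a b cC) ->
  simulates kap Sys step R -> simulates kap Sys step R'.
Proof.
intros HRR' HR J a b cC Hab K f cA a' Hstep; apply HRR' in Hab.
destruct (HR _ _ _ _ Hab _ _ _ _ Hstep) as (I & b' & cB & cC' & Hb & HC & Hent).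
exists I, b', cB, cC'; repeat split; [exact Hb| |exact Hent].
intros i; apply HRR', HC.
Qed.

Lemma simulates_sub (C : category) (O : C) (kap : representative_class C)
    (Sys : reactive_system O) (step step' : step_relation O)
    (R : conditional_relation O) :
  (forall J K a f cA a', step J K a f cA a' -> step' J K a f cA a') ->
  simulates kap Sys step' R -> simulates kap Sys step R.
Proof.
intros Hsub HR J a b cC Hab K f cA a' Hstep.
exact (HR _ _ _ _ Hab _ _ _ _ (Hsub _ _ _ _ _ _ Hstep)).
Qed.

Lemma context_closure_simulates (C : category) (O : C)
    (kap : representative_class C) (Sys : reactive_system O)
    (R : conditional_relation O) :
  simulates kap Sys (representative_step kap Sys) R ->
  simulates kap Sys (context_step kap Sys) (context_closure kap R).
Proof.
intros HR J a b cC (J0 & a0 & b0 & cC0 & d & Hab & -> & -> & HC).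
intros K f cA a' Hstep.
apply context_step_comp, context_step_factor in Hstep.
destruct Hstep as (K0 & f0 & cA0 & a0' & g & Hrep & Ef & -> & HA).
destruct (HR _ _ _ _ Hab _ _ _ _ Hrep) as (I & b' & cB & cC' & Hb & HR' & Hent).
(* The index set is kept; targets and conditions are carried along the remaining context [g]. *)
exists I, (fun i => b' i ;; g), (fun i => shift kap (cB i) g),
  (fun i => shift kap (cC' i) g); repeat split.
- intros i; apply context_step_comp; rewrite Ef.
  now apply context_step_extend.
- intros i; exists K0, a0', (b' i), (cC' i), g; repeat split; auto.
  now intros E h Hh.
- intros E h [HhA HhC].
  (* [Hent] concerns conditions over [K0], so both hypotheses are moved from [h] to [g ;; h]; for
     [HhC] this uses [d ;; f = f0 ;; g]. *)
  apply HA in HhA; unfold sem in HhA, HhC; rewrite sat_shift in HhA, HhC.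
  apply HC in HhC; unfold sem in HhC; rewrite sat_shift in HhC.
  rewrite comp_assoc, Ef, <- comp_assoc in HhC.
  destruct (Hent E (g ;; h)) as (i & HC' & HB).
  { split; [exact HhA|]; unfold sem; now rewrite sat_shift. }
  exists i; split; unfold sem; now rewrite sat_shift.
Qed.

Theorem theorem4p17 (C : category) (O : C) (kap : representative_class C)
    (Sys : reactive_system O) :
  forall (J : C) (a b : hom O J) (cC : cond J),
    conditional_bisimilarity kap Sys a b cC <->
    representative_conditional_bisimilarity kap Sys a b cC.
Proof.
intros J a b cC; split.
(* Representative steps are context steps, so the same relation serves. *)
- intros (R & [H1 H2] & HR); exists R; split; [|exact HR].
  pose proof (representative_step_context (kap := kap) (Sys := Sys)) as Hsub.
  split; apply (simulates_sub Hsub); assumption.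
- intros (R & [H1 H2] & HR).
  exists (context_closure kap R); split; [split|].
  + exact (context_closure_simulates H1).
  (* The converse of the closure is treated as the closure of [converse R], to which the same
     simulation argument applies. *)
  + apply (simulates_ext (context_closure_converse kap R)).
    exact (context_closure_simulates H2).
  + exact (context_closure_incl kap HR).
Qed.
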